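(* Let $h_0,a,b,c\in\mathbb{R}$ with $h_0>0$ (and $c\neq0$), and set $$h_{\mathrm{ini}}(x)=h_0,\qquad u_{\mathrm{ini}}(x)=ax+b,\qquad z_{b,\mathrm{ini}}(x)=\frac{3\xi A_g a}{c}(ax+b)^2 .$$ Let $\tilde W(t)=(\tilde h(t),\tilde u(t),\tilde z_b(t))$ be a solution of the ODE system $$\frac{d}{dt}\tilde h+a\,\tilde u\,\tilde h=0,\qquad \frac{d}{dt}\tilde u+a\,\tilde u^2+\frac{6g\xi A_g a^2}{c}\,\tilde z_b=0,\qquad \frac{d}{dt}\tilde z_b+c\,\tilde u^3=0,$$ with $(\tilde h(0),\tilde u(0),\tilde z_b(0))=(h_0,1,1)$. Then $$W(x,t)=\left(\tilde h(t),\ \tilde h(t)\,u_{\mathrm{ini}}(x)\,\tilde u(t),\ z_{b,\mathrm{ini}}(x)\,\tilde z_b(t)\right)$$ is a smooth solution $W=(h,hu,z_b)$ of the Saint-Venant-Exner system $$\begin{cases}\partial_t h+\partial_x(hu)=0,\\ \partial_t(hu)+\partial_x\left(hu^2+\tfrac12 g h^2\right)=-g h\,\partial_x z_b,\\ \partial_t z_b+\partial_x(\xi A_g u^3)=0,\end{cases}$$ with initial condition $W(x,0)=(h_0,\,h_0u_{\mathrm{ini}}(x),\,z_{b,\mathrm{ini}}(x))$ and suitable boundary conditions.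
   Context: In the one-dimensional Saint-Venant-Exner system, posed for $x$ in a computational domain $[x_a,x_b]$ and $t\ge0$, $h$ is the water thickness, $u$ the velocity (so $hu$ is the discharge), $z_b$ the height of the sediment layer, and $g$ the gravity acceleration. The solid transport discharge is given by the Grass formula $q_b=\xi A_g u|u|^{m_g-1}$ with $m_g=3$, i.e. $q_b=\xi A_g u^3$, where $A_g\in\,]0,1[$ measures the strength of the fluid/sediment interaction and $\xi=1/(1-\rho_0)$ with $\rho_0$ the constant porosity of the sediment layer. *)

(* Defs.v *)
From Stdlib Require Import Reals.
From Coquelicot Require Import Coquelicot.
Open Scope R_scope.

(** ** Calculus on a rectangle [X * I], up to its boundary *)

(* [D_in] restricts the difference quotient to [D]: at an endpoint of an
   interval this is the one-sided derivative. *)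
Definition derive_within (D : R -> Prop) (f : R -> R) (x l : R) : Prop :=
  D_in f (fun _ => l) D x.

Definition is_partial_x (X I : R -> Prop) (f fx : R -> R -> R) : Prop :=
  forall x t, X x -> I t -> derive_within X (fun y => f y t) x (fx x t).

Definition is_partial_t (X I : R -> Prop) (f ft : R -> R -> R) : Prop :=
  forall x t, X x -> I t -> derive_within I (fun s => f x s) t (ft x t).

Fixpoint is_Ck (k : nat) (X I : R -> Prop) (f : R -> R -> R) : Prop :=
  continuous_on (fun p : R * R => X (fst p) /\ I (snd p))
                (fun p : R * R => f (fst p) (snd p)) /\
  match k with
  | O => True
  | S k' => exists fx ft : R -> R -> R,
      is_partial_x X I f fx /\ is_partial_t X I f ft /\
      is_Ck k' X I fx /\ is_Ck k' X I ft
  end.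

Definition is_smooth (X I : R -> Prop) (f : R -> R -> R) : Prop :=
  forall k : nat, is_Ck k X I f.

(* [0, T), [0, T] with T > 0, or [0, +oo) *)
Definition time_interval (I : R -> Prop) : Prop :=
  (forall t, I t -> 0 <= t) /\
  (exists t, 0 < t /\ I t) /\
  (forall s t, 0 <= s <= t -> I t -> I s).

(** ** The Saint-Venant-Exner system *)

(* Conservative unknowns W = (h, hu, z_b). *)
Record state : Type := State { thickness : R; discharge : R; sediment : R }.

(* q_b = xi A_g u |u|^(m_g - 1) with m_g = 3 *)
Definition grass_discharge (xi Ag u : R) : R := xi * Ag * u ^ 3.

(* Positivity of h is part of being a solution: the velocity is recovered from
   W as u = (hu) / h. *)
Definition is_SVE_solution (g xi Ag : R) (X I : R -> Prop)
    (W : R -> R -> state) : Prop :=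
  let h x t := thickness (W x t) in
  let q x t := discharge (W x t) in
  let zb x t := sediment (W x t) in
  let u x t := q x t / h x t in
  (forall x t, X x -> I t -> 0 < h x t) /\
  exists h_t q_x q_t m_x zb_x zb_t qb_x : R -> R -> R,
    is_partial_t X I h h_t /\
    is_partial_x X I q q_x /\
    is_partial_t X I q q_t /\
    is_partial_x X I (fun x t => h x t * u x t ^ 2 + / 2 * g * h x t ^ 2) m_x /\
    is_partial_x X I zb zb_x /\
    is_partial_t X I zb zb_t /\
    is_partial_x X I (fun x t => grass_discharge xi Ag (u x t)) qb_x /\
    (forall x t, X x -> I t ->
       h_t x t + q_x x t = 0 /\
       q_t x t + m_x x t = - g * h x t * zb_x x t /\
       zb_t x t + qb_x x t = 0).

Definition is_smooth_SVE_solution (g xi Ag : R) (X I : R -> Prop)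
    (W : R -> R -> state) : Prop :=
  is_smooth X I (fun x t => thickness (W x t)) /\
  is_smooth X I (fun x t => discharge (W x t)) /\
  is_smooth X I (fun x t => sediment (W x t)) /\
  is_SVE_solution g xi Ag X I W.

Definition satisfies_initial_condition (X : R -> Prop) (W : R -> R -> state)
    (W0 : R -> state) : Prop :=
  forall x, X x -> W x 0 = W0 x.

(* Dirichlet data at both ends of the domain *)
Definition satisfies_boundary_conditions (xa xb : R) (I : R -> Prop)
    (W : R -> R -> state) (Wa Wb : R -> state) : Prop :=
  forall t, I t -> W xa t = Wa t /\ W xb t = Wb t.

(** ** Initial data and the associated ODE system *)

Definition u_ini (a b x : R) : R := a * x + b.

Definition zb_ini (xi Ag a b c x : R) : R :=
  3 * xi * Ag * a / c * (a * x + b) ^ 2.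

Definition is_ODE_solution (g xi Ag a c : R) (I : R -> Prop)
    (h u z : R -> R) : Prop :=
  exists h' u' z' : R -> R,
    forall t, I t ->
      derive_within I h t (h' t) /\
      derive_within I u t (u' t) /\
      derive_within I z t (z' t) /\
      h' t + a * u t * h t = 0 /\
      u' t + a * u t ^ 2 + 6 * g * xi * Ag * a ^ 2 / c * z t = 0 /\
      z' t + c * u t ^ 3 = 0.

(* Main.v *)
Require Import Defs.
From Stdlib Require Import Reals Lra.
From Coquelicot Require Import Coquelicot.
Open Scope R_scope.

(** The velocity is linear in [x] and the thickness does not depend on [x], so
    the PDEs reduce to the ODEs after cancelling powers of [a x + b].
    Two points need an argument.  The thickness stays positive because
    [h exp (int a u)] is constant in time.  Smoothness follows because the
    algebra of functions generated by the constants, [x], [h(t)], [u(t)] and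
    [z(t)] is stable under both partial derivatives: the right-hand sides of the
    ODEs are polynomials in the unknowns. *)

(** * Calculus of derivatives relative to a subset of the line *)

Lemma derive_within_eq (D : R -> Prop) (f : R -> R) (x l l' : R) :
  derive_within D f x l -> l = l' -> derive_within D f x l'.
Proof. now intros Hf <-. Qed.

Lemma derive_within_const (D : R -> Prop) (k x : R) :
  derive_within D (fun _ => k) x 0.
Proof. exact (Dconst D k x). Qed.

Lemma derive_within_id (D : R -> Prop) (x : R) :
  derive_within D (fun y => y) x 1.
Proof. exact (Dx D x). Qed.

Lemma derive_within_plus (D : R -> Prop) (f f' : R -> R) (x l l' : R) :
  derive_within D f x l -> derive_within D f' x l' ->
  derive_within D (fun y => f y + f' y) x (l + l').
Proof. exact (Dadd D (fun _ => l) (fun _ => l') f f' x). Qed.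

Lemma derive_within_mult (D : R -> Prop) (f f' : R -> R) (x l l' : R) :
  derive_within D f x l -> derive_within D f' x l' ->
  derive_within D (fun y => f y * f' y) x (l * f' x + f x * l').
Proof. exact (Dmult D (fun _ => l) (fun _ => l') f f' x). Qed.

(** Restricting the increments to [D] only weakens the limit. This lets the partial derivatives in
    [x] be computed as ordinary ones. *)
Lemma is_derive_derive_within (D : R -> Prop) (f : R -> R) (x l : R) :
  is_derive f x l -> derive_within D f x l.
Proof.
  intros Hf%is_derive_Reals eps Heps.
  destruct (Hf eps Heps) as [d Hd].
  exists d; split; [apply cond_pos |].
  intros y [[_ Hxy] Hy].
  specialize (Hd (y - x)); simpl in *; unfold Rdist in *.
  replace (x + (y - x)) with y in Hd by ring.
  apply Hd; lra.
Qed.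

(** Near an interior point every small increment stays in [D], so the restriction disappears. The
    mean value theorem below needs this form. *)
Lemma derive_within_is_derive (D : R -> Prop) (f : R -> R) (x l : R) :
  locally x D -> derive_within D f x l -> is_derive f x l.
Proof.
  intros [r Hr] Hf; apply is_derive_Reals; intros eps Heps.
  destruct (Hf eps Heps) as [d [Hd Hlim]].
  exists (mkposreal (Rmin d r) (Rmin_pos _ _ Hd (cond_pos r))).
  intros k Hk Hkd; simpl in Hkd.
  pose proof (Rmin_l d r); pose proof (Rmin_r d r).
  specialize (Hlim (x + k)); simpl in Hlim; unfold Rdist in Hlim.
  replace (x + k - x) with k in Hlim by ring.
  apply Hlim; split; [split; [| lra] | lra].
  apply Hr; change (Rabs (x + k - x) < r).
  replace (x + k - x) with k by ring; lra.
Qed.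

Lemma derive_within_filterlim (D : R -> Prop) (f : R -> R) (x l : R) :
  derive_within D f x l -> filterlim f (within D (locally x)) (locally (f x)).
Proof.
  intros Hf%cont_deriv; apply filterlim_locally; intros eps.
  destruct (Hf eps (cond_pos eps)) as [d [Hd Hlim]].
  exists (mkposreal d Hd); intros y Hy HDy.
  (* The limit given by [cont_deriv] excludes the point [x] itself, whereas [within] includes it. *)
  destruct (Req_dec x y) as [<- | Hxy]; [apply ball_center |].
  now apply (Hlim y).
Qed.

(** * Smoothness from stability under both partial derivatives *)

Lemma is_smooth_of_stable (P : (R -> R -> R) -> Prop) (X I : R -> Prop) :
  (forall f, P f ->
     continuous_on (fun p : R * R => X (fst p) /\ I (snd p))
                   (fun p => f (fst p) (snd p)) /\
     exists fx ft, is_partial_x X I f fx /\ is_partial_t X I f ft /\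
                   P fx /\ P ft) ->
  forall f, P f -> is_smooth X I f.
Proof.
  intros HP f Hf k; revert f Hf.
  induction k as [| k IH]; intros f Hf; destruct (HP f Hf) as [Hc Hp].
  - now split.
  - split; [exact Hc |].
    destruct Hp as (fx & ft & Hx & Ht & Px & Pt).
    exists fx, ft; repeat split; auto.
Qed.

(** The algebra of polynomials in [x] and in the functions of time from [G]. Being inductive, it
    reduces stability under differentiation to the generators, by the sum and Leibniz rules. *)
Inductive generated_by (G : (R -> R) -> Prop) : (R -> R -> R) -> Prop :=
| gen_const k : generated_by G (fun _ _ => k)
| gen_x : generated_by G (fun x _ => x)
| gen_t v : G v -> generated_by G (fun _ t => v t)
| gen_plus f f' : generated_by G f -> generated_by G f' ->
    generated_by G (fun x t => f x t + f' x t)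
| gen_mult f f' : generated_by G f -> generated_by G f' ->
    generated_by G (fun x t => f x t * f' x t).

Lemma continuous_on_generated (G : (R -> R) -> Prop) (X I : R -> Prop) :
  (forall v t, G v -> I t ->
     filterlim v (within I (locally t)) (locally (v t))) ->
  forall f, generated_by G f ->
  continuous_on (fun p : R * R => X (fst p) /\ I (snd p))
                (fun p => f (fst p) (snd p)).
Proof.
  intros HG f Hf; induction Hf as [k | | v Hv | f f' _ IH _ IH' | f f' _ IH _ IH'];
    intros [x t] [Hx Ht]; simpl in *.
  - apply filterlim_const.
  - intros Q HQ.
    destruct HQ as [d Hd]; exists d; intros [y s] [Hy _] _; now apply Hd.
  - intros Q HQ.
    destruct (HG v t Hv Ht Q HQ) as [d Hd].
    exists d; intros [y s] [_ Hs] [_ His]; now apply Hd.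
  - eapply filterlim_comp_2;
      [exact (IH (x, t) (conj Hx Ht)) | exact (IH' (x, t) (conj Hx Ht)) |].
    apply (filterlim_plus (K := R_AbsRing) (V := R_NormedModule)).
  - eapply filterlim_comp_2;
      [exact (IH (x, t) (conj Hx Ht)) | exact (IH' (x, t) (conj Hx Ht)) |].
    apply (filterlim_mult (K := R_AbsRing)).
Qed.

Lemma is_smooth_generated (G : (R -> R) -> Prop) (X I : R -> Prop) :
  (forall v, G v -> exists v', generated_by G v' /\
     forall x t, I t -> derive_within I v t (v' x t)) ->
  forall f, generated_by G f -> is_smooth X I f.
Proof.
  intros HG; apply is_smooth_of_stable; intros f Hf; split.
  - apply (continuous_on_generated G); [| exact Hf].
    intros v t Hv Ht; destruct (HG v Hv) as (v' & _ & Hd).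
    (* The value 0 for [x] is arbitrary: [v] depends on time only. *)
    exact (derive_within_filterlim _ _ _ _ (Hd 0 t Ht)).
  - induction Hf as [k | | v Hv | f f' Hf IH Hf' IH' | f f' Hf IH Hf' IH'].
    + exists (fun _ _ => 0), (fun _ _ => 0).
      repeat split; try apply gen_const; intros x t _ _; apply derive_within_const.
    + exists (fun _ _ => 1), (fun _ _ => 0).
      repeat split; try apply gen_const; intros x t _ _.
      * apply derive_within_id.
      * apply derive_within_const.
    + destruct (HG v Hv) as (v' & Gv' & Hd).
      exists (fun _ _ => 0), v'.
      repeat split; [| | apply gen_const | exact Gv']; intros x t _ Ht.
      * apply derive_within_const.
      * now apply Hd.
    + destruct IH as (fx & ft & Hx & Ht & Gx & Gt).
      destruct IH' as (fx' & ft' & Hx' & Ht' & Gx' & Gt').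
      exists (fun x t => fx x t + fx' x t), (fun x t => ft x t + ft' x t).
      repeat split; try (now apply gen_plus); intros x t HX HI;
        apply derive_within_plus; auto.
    + destruct IH as (fx & ft & Hx & Ht & Gx & Gt).
      destruct IH' as (fx' & ft' & Hx' & Ht' & Gx' & Gt').
      exists (fun x t => fx x t * f' x t + f x t * fx' x t),
             (fun x t => ft x t * f' x t + f x t * ft' x t).
      repeat split; try (now apply gen_plus; apply gen_mult); intros x t HX HI.
      * apply (derive_within_mult X (fun y => f y t) (fun y => f' y t)); auto.
      * apply (derive_within_mult I (f x) (f' x)); auto.
Qed.

(** * Positivity for a scalar linear ODE *)

(* Extends a function on [0, T] to the real line. *)
Definition clamp (T s : R) : R := Rmax 0 (Rmin s T).

Lemma clamp_bounds (T s : R) : 0 <= T -> 0 <= clamp T s <= T.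
Proof.
  intros HT; unfold clamp, Rmax, Rmin.
  destruct (Rle_dec s T); destruct Rle_dec; lra.
Qed.

Lemma clamp_id (T s : R) : 0 <= s <= T -> clamp T s = s.
Proof.
  intros Hs; unfold clamp; now rewrite Rmin_left, Rmax_right.
Qed.

Lemma clamp_lipschitz (T s s' : R) :
  Rabs (clamp T s' - clamp T s) <= Rabs (s' - s).
Proof.
  unfold clamp, Rmax, Rmin.
  destruct (Rle_dec s T); destruct (Rle_dec s' T);
    repeat destruct Rle_dec; unfold Rabs; repeat destruct Rcase_abs; lra.
Qed.

(** [clamp] is 1-Lipschitz with values in [0, T], so continuity relative to [I] becomes two-sided
    continuity on the whole line, as integration and the mean value theorem require. *)
Lemma continuous_clamp (I : R -> Prop) (v : R -> R) (T s : R) :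
  0 <= T -> (forall r, 0 <= r <= T -> I r) ->
  filterlim v (within I (locally (clamp T s))) (locally (v (clamp T s))) ->
  continuous (fun r => v (clamp T r)) s.
Proof.
  intros HT HI Hv Q HQ.
  destruct (Hv Q HQ) as [d Hd]; exists d; intros r Hr; apply Hd.
  - exact (Rle_lt_trans _ _ _ (clamp_lipschitz T s r) Hr).
  - now apply HI, clamp_bounds.
Qed.

(** Integrating factor: if F' = p, then (h exp F)' = 0, so h(T) exp F(T) = h(0) exp F(0) > 0. The
    final time [T] is fixed first and serves as the clamping bound. *)
Lemma linear_ode_positive (I : R -> Prop) (h p : R -> R) :
  time_interval I ->
  (forall t, I t -> filterlim p (within I (locally t)) (locally (p t))) ->
  (forall t, I t -> derive_within I h t (- p t * h t)) ->
  0 < h 0 -> forall t, I t -> 0 < h t.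
Proof.
  intros (Hpos & _ & Hdown) Hp Hh Hh0 T HT.
  pose proof (Hpos T HT) as HT0.
  assert (HI : forall r, 0 <= r <= T -> I r) by (intros r Hr; now apply (Hdown r T)).
  assert (Hpc : forall s, continuous (fun r => p (clamp T r)) s)
    by (intros s; apply (continuous_clamp I); auto; now apply Hp, HI, clamp_bounds).
  (* With the clamped integrand, [F] is differentiable at every real, the endpoints 0 and [T]
     included. *)
  set (F := fun t => RInt (fun r => p (clamp T r)) 0 t).
  assert (HF : forall s, is_derive F s (p (clamp T s))).
  { intros s; apply (is_derive_RInt (fun r => p (clamp T r)) F 0 s); [| apply Hpc].
    apply filter_forall; intros y; apply (RInt_correct (V := R_CompleteNormedModule)).
    apply (ex_RInt_continuous (V := R_CompleteNormedModule)); auto. }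
  set (K := fun t => h (clamp T t) * exp (F t)).
  assert (HK : K T = K 0).
  { destruct (MVT_gen K 0 T (fun _ => 0)) as (c & _ & Hc); [| | lra];
      rewrite Rmin_left, Rmax_right by lra; intros s Hs.
    (* On the open interval [clamp] is locally the identity and [s] is interior to [I], so the
       relative derivative of [h] is an ordinary one. *)
    - assert (Hhs : is_derive (fun t => h (clamp T t)) s (- p s * h s)).
      { apply (is_derive_ext_loc h).
        - apply (locally_interval _ s 0 T); simpl; try lra.
          intros y Hy0 HyT; rewrite clamp_id by lra; reflexivity.
        - apply (derive_within_is_derive I); [| apply Hh, HI; lra].
          apply (locally_interval _ s 0 T); simpl; try lra.
          intros y Hy0 HyT; apply HI; lra. }
      pose proof (HF s) as HFs; rewrite clamp_id in HFs by lra.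
      evar_last; [apply (is_derive_mult (fun t => h (clamp T t)) (fun t => exp (F t)) s);
        [exact Hhs
        | apply (is_derive_comp exp F s); [apply is_derive_exp | exact HFs]
        | intros; apply Rmult_comm] |].
      unfold plus, mult, scal; simpl; unfold mult; simpl.
      rewrite clamp_id by lra; ring.
    (* At 0 and [T] only continuity is asked, and the clamped [h] has it even where [h] is
       differentiable on one side only. *)
    - apply continuity_pt_filterlim.
      apply (continuous_mult (fun t => h (clamp T t)) (fun t => exp (F t))).
      + apply (continuous_clamp I); auto.
        apply (derive_within_filterlim _ _ _ _ (Hh _ (HI _ (clamp_bounds T s HT0)))).
      + apply (continuous_comp F exp).
        * apply (ex_derive_continuous (V := R_NormedModule)); eexists; apply HF.
        * apply (ex_derive_continuous (V := R_NormedModule)); eexists; apply is_derive_exp. }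
  unfold K in HK; rewrite !clamp_id in HK by lra.
  pose proof (exp_pos (F T)) as HeT; pose proof (exp_pos (F 0)) as He0.
  apply (Rmult_lt_reg_r (exp (F T))); [exact HeT |].
  rewrite HK, Rmult_0_l; now apply Rmult_lt_0_compat.
Qed.

(** * Verification of the explicit solution *)

Theorem mainTheorem2 :
  forall (g Ag rho0 xi xa xb h0 a b c : R) (I : R -> Prop)
         (ht ut zt : R -> R),
    0 < g ->
    0 < Ag < 1 ->
    0 <= rho0 < 1 ->
    xi = 1 / (1 - rho0) ->
    xa < xb ->
    0 < h0 ->
    c <> 0 ->
    time_interval I ->
    is_ODE_solution g xi Ag a c I ht ut zt ->
    ht 0 = h0 -> ut 0 = 1 -> zt 0 = 1 ->
    let X := fun x => xa <= x <= xb in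
    let W := fun x t =>
      State (ht t) (ht t * u_ini a b x * ut t)
            (zb_ini xi Ag a b c x * zt t) in
    is_smooth_SVE_solution g xi Ag X I W /\
    satisfies_initial_condition X W
      (fun x => State h0 (h0 * u_ini a b x) (zb_ini xi Ag a b c x)) /\
    (exists Wa Wb : R -> state,
       satisfies_boundary_conditions xa xb I W Wa Wb).
Proof.
  intros g Ag rho0 xi xa xb h0 a b c I ht ut zt _ _ _ _ _ Hh0 Hc HI
    (h' & u' & z' & Hode) Eh Eu Ez X W.
  assert (Dh : forall t, I t -> derive_within I ht t (- (a * ut t) * ht t)).
  { intros t Ht; destruct (Hode t Ht) as (Hd & _ & _ & E & _).
    apply (derive_within_eq _ _ _ _ _ Hd); lra. }
  assert (Du : forall t, I t -> derive_within I ut t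
            (- a * (ut t * ut t) + - (6 * g * xi * Ag * a ^ 2 / c) * zt t)).
  { intros t Ht; destruct (Hode t Ht) as (_ & Hd & _ & _ & E & _).
    apply (derive_within_eq _ _ _ _ _ Hd); lra. }
  assert (Dz : forall t, I t -> derive_within I zt t (- c * (ut t * (ut t * ut t)))).
  { intros t Ht; destruct (Hode t Ht) as (_ & _ & Hd & _ & _ & E).
    apply (derive_within_eq _ _ _ _ _ Hd); lra. }
  assert (Hpos : forall t, I t -> 0 < ht t).
  { apply (linear_ode_positive I ht (fun t => a * ut t)); auto; [| lra].
    intros t Ht; apply (derive_within_filterlim _ (fun t => a * ut t) _ _
      (derive_within_mult _ _ _ _ _ _ (derive_within_const I a t) (Du t Ht))). }
  set (G := fun v => v = ht \/ v = ut \/ v = zt).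
  assert (Gh : generated_by G (fun _ t => ht t)) by (apply gen_t; now left).
  assert (Gu : generated_by G (fun _ t => ut t)) by (apply gen_t; now right; left).
  assert (Gz : generated_by G (fun _ t => zt t)) by (apply gen_t; now right; right).
  assert (Glin : generated_by G (fun x _ => a * x + b))
    by repeat first [apply gen_plus | apply gen_mult | apply gen_const | apply gen_x].
  assert (Smooth : forall f, generated_by G f -> is_smooth X I f).
  { apply is_smooth_generated; intros v [-> | [-> | ->]].
    (* The sign is written as the constant factor -1, since opposites are not among the constructors
       of [generated_by]. *)
    - exists (fun _ t => (-1) * (a * ut t) * ht t); split.
      + repeat first [assumption | apply gen_mult | apply gen_const].
      + intros _ t Ht; apply (derive_within_eq _ _ _ _ _ (Dh t Ht)); ring.
    - exists (fun _ t => - a * (ut t * ut t) + - (6 * g * xi * Ag * a ^ 2 / c) * zt t); split.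
      + apply gen_plus;
          repeat first [apply gen_const | assumption | apply gen_mult].
      + auto.
    - exists (fun _ t => - c * (ut t * (ut t * ut t))); split.
      + repeat first [apply gen_const | assumption | apply gen_mult].
      + auto. }
  split; [| split].
  - split; [| split; [| split]].
    + exact (Smooth _ Gh).
    + apply Smooth; exact (gen_mult G _ _ (gen_mult G _ _ Gh Glin) Gu).
    (* The square in [zb_ini] unfolds to y * (y * 1), whence the trailing constant 1. *)
    + apply Smooth; exact (gen_mult G _ _ (gen_mult G _ _
        (gen_const G (3 * xi * Ag * a / c))
        (gen_mult G _ _ Glin (gen_mult G _ _ Glin (gen_const G 1)))) Gz).
    + split; [intros x t _ Ht; exact (Hpos t Ht) |]; simpl.
      (* The time derivatives come from the ODEs. The flux derivatives are those obtained once q / h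
         has been simplified to [u_ini a b x * ut t]. *)
      exists (fun _ t => - (a * ut t) * ht t),
        (fun _ t => ht t * a * ut t),
        (fun x t => u_ini a b x * (- (a * ut t) * ht t * ut t + ht t *
           (- a * (ut t * ut t) + - (6 * g * xi * Ag * a ^ 2 / c) * zt t))),
        (fun x t => 2 * a * ht t * u_ini a b x * ut t ^ 2),
        (fun x t => 6 * xi * Ag * a ^ 2 / c * u_ini a b x * zt t),
        (fun x t => zb_ini xi Ag a b c x * (- c * (ut t * (ut t * ut t)))),
        (fun x t => 3 * xi * Ag * a * u_ini a b x ^ 2 * ut t ^ 3).
      repeat apply conj.
      * intros x t _ Ht; auto.
      * intros x t _ Ht; apply is_derive_derive_within; unfold u_ini.
        auto_derive; [trivial | ring].
      * intros x t _ Ht.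
        eapply derive_within_eq;
          [apply (derive_within_mult I (fun s => ht s * u_ini a b x) ut);
             [apply (derive_within_mult I ht (fun _ => u_ini a b x));
                [exact (Dh t Ht) | apply derive_within_const]
             | exact (Du t Ht)] |].
        ring.
      * intros x t _ Ht; apply is_derive_derive_within; unfold u_ini.
        (* Positivity of [ht t] allows the division by the thickness in the velocity. *)
        pose proof (Hpos t Ht).
        auto_derive; [repeat split; lra | field; lra].
      * intros x t _ Ht; apply is_derive_derive_within; unfold u_ini, zb_ini.
        auto_derive; [trivial | field; lra].
      * intros x t _ Ht.
        eapply derive_within_eq;
          [apply (derive_within_mult I (fun _ => zb_ini xi Ag a b c x) zt);
             [apply derive_within_const | exact (Dz t Ht)] |].
        ring.
      * intros x t _ Ht; apply is_derive_derive_within; unfold u_ini, grass_discharge.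
        pose proof (Hpos t Ht).
        auto_derive; [repeat split; lra | field; lra].
      (* In the momentum equation the mass and velocity ODEs contribute -2 a h u_ini u^2 to q_t,
         which cancels m_x; the term in [zt] remains and equals -g h zb_x. The factor 3 xi A_g a / c
         in [zb_ini] makes the sediment equation balance. *)
      * intros x t _ Ht; unfold u_ini, zb_ini; repeat split; field; lra.
  - intros x _; unfold W; rewrite Eh, Eu, Ez; f_equal; ring.
  (* The boundary data are the traces of [W] at the two ends. *)
  - exists (W xa), (W xb); now split.
Qed.
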